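(* Let $\{a_1,\dots,a_n\}$ be a set of distinct complex numbers and $a=(a_1,\dots,a_n)$. Then all derivations of the Lie algebra $\mathscr{V}_a$ are inner derivations.
   Context: $n\ge1$. $R_a$ is the subalgebra of $\mathbb{C}(t)$ generated by $t,(t-a_1)^{-1},\dots,(t-a_n)^{-1}$, and $\mathscr{V}_a=\operatorname{Der}(R_a)=R_a\partial$ with $\partial=d/dt$, a complex Lie algebra with bracket $[f\partial,g\partial]=(f\partial(g)-g\partial(f))\partial$. *)

(* Defs.v *)
From HB Require Import structures.
From mathcomp Require Import all_boot all_algebra generic_quotient fraction.
From mathcomp Require Import boolp functions ring.

Set Implicit Arguments.
Unset Strict Implicit.
Unset Printing Implicit Defensive.

Import GRing.Theory.
Local Open Scope ring_scope.

HB.mixin Record Lmodule_isLieAlgebra (K : pzRingType) V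
    of GRing.Lmodule K V := {
  lie : V -> V -> V;
  lie_linearl : forall y, linear (lie^~ y);
  lie_linearr : forall x, linear (lie x);
  liexx : forall x, lie x x = 0;
  lie_jacobi : forall x y z,
    lie x (lie y z) + lie y (lie z x) + lie z (lie x y) = 0
}.

#[short(type="lieAlgType")]
HB.structure Definition LieAlgebra (K : pzRingType) :=
  { V of GRing.Lmodule K V & Lmodule_isLieAlgebra K V }.

Section LieDerivations.
Variables (K : pzRingType) (L : lieAlgType K).

Definition lie_derivation (D : {linear L -> L}) : Prop :=
  forall x y, D (lie x y) = lie (D x) y + lie x (D y).

Definition inner_derivation (D : {linear L -> L}) : Prop :=
  exists x, forall y, D y = lie x y.

End LieDerivations.

Section AlgebraDerivations.
Variables (K : comNzRingType) (A : comAlgType K).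
Implicit Types D E : A -> A.

Definition derivation D : Prop :=
  linear D /\ forall f g, D (f * g) = D f * g + f * D g.

Definition der_pred : {pred A -> A} := fun D => `[< derivation D >].

Lemma der_submod_closed : GRing.submod_closed der_pred.
Proof.
split=> [|c D E /asboolP[lD mD] /asboolP[lE mE]]; apply/asboolP; split.
- move=> c f g; change (0 = c *: 0 + 0 :> A); by rewrite scaler0 addr0.
- move=> f g; change (0 = 0 * g + f * 0 :> A); by rewrite mul0r mulr0 addr0.
- move=> b f g.
  change (c *: D (b *: f + g) + E (b *: f + g)
          = b *: (c *: D f + E f) + (c *: D g + E g)).
  by rewrite lD lE !scalerDr !scalerA (mulrC c b) addrACA.
- move=> f g.
  change (c *: D (f * g) + E (f * g)
          = (c *: D f + E f) * g + f * (c *: D g + E g)).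
  rewrite mD mE scalerDr mulrDl mulrDr -scalerAl -scalerAr.
  by rewrite addrACA.
Qed.

HB.instance Definition _ :=
  GRing.isSubmodClosed.Build K (A -> A) der_pred
    (GRing.subsemimod_closed_submod der_submod_closed).

Definition Der : Type := {D : A -> A | D \in der_pred}.

HB.instance Definition _ := SubType.on Der.
HB.instance Definition _ := [Choice of Der by <:].
HB.instance Definition _ := [SubChoice_isSubZmodule of Der by <:].
HB.instance Definition _ := [SubZmodule_isSubLmodule of Der by <:].

Lemma commutator_derivation D E :
  derivation D -> derivation E -> derivation (fun f => D (E f) - E (D f)).
Proof.
move=> [lD mD] [lE mE].
have aD x y : D (x + y) = D x + D y by have := lD 1 x y; rewrite !scale1r.
have aE x y : E (x + y) = E x + E y by have := lE 1 x y; rewrite !scale1r.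
split=> [c f g|f g]; first by rewrite lE lD lD lE scalerBr opprD addrACA.
by rewrite mE mD aD aE !mD !mE; ring.
Qed.

Lemma Der_derivation (D : Der) : derivation (val D).
Proof. exact/asboolP/(valP D). Qed.

Definition mkDer D (hD : derivation D) : Der :=
  exist (fun D => D \in der_pred) D (introT (asboolP _) hD).

Definition Der_lie (D E : Der) : Der :=
  mkDer (commutator_derivation (Der_derivation D) (Der_derivation E)).

Lemma DerP (D E : Der) : (forall f, val D f = val E f) -> D = E.
Proof. by move=> DE; apply/val_inj/funext. Qed.

Lemma Der_linear (D : Der) : linear (val D).
Proof. by have [] := Der_derivation D. Qed.

Lemma Der_linearl (E : Der) : linear (Der_lie^~ E).
Proof.
move=> c D1 D2; apply: DerP => f.
change (c *: val D1 (val E f) + val D2 (val E f)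
        - val E (c *: val D1 f + val D2 f)
        = c *: (val D1 (val E f) - val E (val D1 f))
          + (val D2 (val E f) - val E (val D2 f))).
by rewrite Der_linear scalerBr opprD addrACA.
Qed.

Lemma Der_lieC (D E : Der) : Der_lie D E = - Der_lie E D.
Proof.
apply: DerP => f.
change (val D (val E f) - val E (val D f)
        = - (val E (val D f) - val D (val E f))).
by rewrite opprB.
Qed.

Lemma Der_linearr (D : Der) : linear (Der_lie D).
Proof.
move=> c E1 E2; rewrite Der_lieC Der_linearl opprD -scalerN.
by rewrite -!Der_lieC.
Qed.

Lemma Der_liexx (D : Der) : Der_lie D D = 0.
Proof. by apply: DerP => f; apply: subrr. Qed.

Lemma DerB (D : Der) : {morph val D : f g / f - g}.
Proof.
by move=> f g; rewrite addrC -scaleN1r Der_linear scaleN1r addrC.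
Qed.

Lemma Der_jacobi (D1 D2 D3 : Der) :
  Der_lie D1 (Der_lie D2 D3) + Der_lie D2 (Der_lie D3 D1)
  + Der_lie D3 (Der_lie D1 D2) = 0.
Proof.
apply: DerP => f; pose d1 := val D1; pose d2 := val D2; pose d3 := val D3.
change (d1 (d2 (d3 f) - d3 (d2 f)) - (d2 (d3 (d1 f)) - d3 (d2 (d1 f)))
  + (d2 (d3 (d1 f) - d1 (d3 f)) - (d3 (d1 (d2 f)) - d1 (d3 (d2 f))))
  + (d3 (d1 (d2 f) - d2 (d1 f)) - (d1 (d2 (d3 f)) - d2 (d1 (d3 f)))) = 0).
by rewrite /d1 /d2 /d3 !DerB; ring.
Qed.

HB.instance Definition _ := Lmodule_isLieAlgebra.Build K Der
  Der_linearl Der_linearr Der_liexx Der_jacobi.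

Lemma Der_lieE (D E : Der) f :
  val (lie D E) f = val D (val E f) - val E (val D f).
Proof. by []. Qed.

End AlgebraDerivations.

Section GeneratedSubalgebra.
Variables (K : pzRingType) (A : lalgType K) (G : A -> Prop).

Definition genalg : {pred A} := fun x =>
  `[< forall S : {pred A},
        GRing.subalg_closed S -> (forall g, G g -> g \in S) -> x \in S >].

Lemma genalg_closed : GRing.subalg_closed genalg.
Proof.
split=> [|c x y /asboolP hx /asboolP hy|x y /asboolP hx /asboolP hy].
- by apply/asboolP => S [].
- apply/asboolP => S /[dup] cS [_ lS _] GS.
  by apply: lS; [apply: hx|apply: hy].
- apply/asboolP => S /[dup] cS [_ _ mS] GS.
  by apply: mS; [apply: hx|apply: hy].
Qed.

Lemma sub_genalg x : G x -> x \in genalg.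
Proof. by move=> Gx; apply/asboolP => S _; apply. Qed.

HB.instance Definition _ :=
  GRing.isSubalgClosed.Build K A genalg
    (GRing.subalg_closed_semi genalg_closed).

End GeneratedSubalgebra.

Section QuotientRule.
(* The abstract field keeps [field] from unfolding fractions of polynomials. *)
Variable F : fieldType.
Implicit Types c n d m e : F.

Fact quotient_ruleD c n n' d d' m m' e e' : d != 0 -> e != 0 ->
  ((0 * n + c * n') * e + c * n * e' + (m' * d + m * d')) * (d * e)
    - (c * n * e + m * d) * (d' * e + d * e')
  = (c * ((n' * d - n * d') / d ^+ 2) + (m' * e - m * e') / e ^+ 2)
    * (d * e) ^+ 2.
Proof. by move=> d0 e0; field; rewrite d0 e0. Qed.

Fact quotient_ruleM n n' d d' m m' e e' : d != 0 -> e != 0 ->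
  ((n' * m + n * m') * (d * e) - n * m * (d' * e + d * e')) / (d * e) ^+ 2
  = (n' * d - n * d') / d ^+ 2 * (m / e)
    + n / d * ((m' * e - m * e') / e ^+ 2).
Proof. by move=> d0 e0; field; rewrite d0 e0. Qed.

End QuotientRule.

Section RationalFunctions.
Variable K : fieldType.

(* An alias, since the library gives [{fraction {poly K}}] no K-algebra
   structure. *)
Definition ratfun : Type := {fraction {poly K}}.

HB.instance Definition _ := GRing.Field.on ratfun.

Definition ratfun_of_poly : {poly K} -> ratfun := @FracField.tofrac {poly K}.

HB.instance Definition _ := GRing.RMorphism.on ratfun_of_poly.

Definition ratX : ratfun := ratfun_of_poly 'X.

Definition ratfun_scale (c : K) (f : ratfun) : ratfun :=
  ratfun_of_poly c%:P * f.

Fact ratfun_scaleA a b v :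
  ratfun_scale a (ratfun_scale b v) = ratfun_scale (a * b) v.
Proof. by rewrite /ratfun_scale polyCM rmorphM mulrA. Qed.
Fact ratfun_scale1 : left_id 1 ratfun_scale.
Proof. by move=> v; rewrite /ratfun_scale rmorph1 mul1r. Qed.
Fact ratfun_scaleDr : right_distributive ratfun_scale +%R.
Proof. by move=> a u v; rewrite /ratfun_scale mulrDr. Qed.
Fact ratfun_scaleDl v : {morph ratfun_scale^~ v : a b / a + b}.
Proof. by move=> a b; rewrite /ratfun_scale polyCD rmorphD mulrDl. Qed.

HB.instance Definition _ := GRing.Zmodule_isLmodule.Build K ratfun
  ratfun_scaleA ratfun_scale1 ratfun_scaleDr ratfun_scaleDl.

Fact ratfun_scaleAl (c : K) (f g : ratfun) : c *: (f * g) = (c *: f) * g.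
Proof. exact: mulrA. Qed.
HB.instance Definition _ :=
  GRing.Lmodule_isLalgebra.Build K ratfun ratfun_scaleAl.

Fact ratfun_scaleAr (c : K) (f g : ratfun) : c *: (f * g) = f * (c *: g).
Proof. exact: mulrCA. Qed.
HB.instance Definition _ :=
  GRing.Lalgebra_isAlgebra.Build K ratfun ratfun_scaleAr.

Local Notation "p %:F" := (ratfun_of_poly p).

Lemma ratfun_scaleE c f : c *: f = c%:P%:F * f.
Proof. by []. Qed.

Lemma ratfun_of_poly_eq0 p : (p%:F == 0) = (p == 0).
Proof. exact: tofrac_eq0. Qed.

Lemma ratfun_of_polyI : injective ratfun_of_poly.
Proof. by move=> p q /eqP; rewrite tofrac_eq => /eqP. Qed.

Lemma repr_ratfun (f : ratfun) : f * (\d_(repr f))%:F = (\n_(repr f))%:F.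
Proof.
rewrite -{1}[f]reprK /ratfun_of_poly; set x := repr f.
unlock FracField.tofrac; rewrite -[LHS]FracField.pi_mul.
apply/eqmodP; rewrite /= FracField.equivfE /FracField.mulf /=.
rewrite !numden_Ratio ?(mulf_neq0, oner_neq0, denom_ratioP) //.
by rewrite !mulr1 mulrC.
Qed.

Definition ratfun_deriv (f : ratfun) : ratfun :=
  let n := \n_(repr f) in let d := \d_(repr f) in
  (n^`() * d - n * d^`())%:F / (d ^+ 2)%:F.

Lemma ratfun_derivE f p q : f * q%:F = p%:F -> q != 0 ->
  ratfun_deriv f * (q ^+ 2)%:F = (p^`() * q - p * q^`())%:F.
Proof.
move=> fq q0; rewrite /ratfun_deriv.
have := repr_ratfun f; have := denom_ratioP (repr f).
move: (\n_(repr f)) (\d_(repr f)) => n d d0 fd.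
have e : n * q = p * d.
  by apply: ratfun_of_polyI; rewrite !rmorphM /= -fd -fq; ring.
have e' : n^`() * q + n * q^`() = p^`() * d + p * d^`().
  by rewrite -!derivM e.
have D0 : (d ^+ 2)%:F != 0 by rewrite ratfun_of_poly_eq0 expf_neq0.
apply: (mulIf D0); rewrite mulrAC mulfVK // -!rmorphM.
congr ratfun_of_poly; apply/eqP; rewrite -subr_eq0; apply/eqP.
transitivity (d * q * (n^`() * q + n * q^`() - (p^`() * d + p * d^`()))
  - (n * q - p * d) * (d * q^`() + q * d^`())); first by ring.
by rewrite e e' !subrr mulr0 mul0r subrr.
Qed.

Lemma ratfun_deriv_poly p : ratfun_deriv p%:F = (p^`())%:F.
Proof.
have := @ratfun_derivE p%:F p 1.
rewrite rmorph1 mulr1 => /(_ erefl (oner_neq0 _)).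
by rewrite expr1n rmorph1 !mulr1 -polyC1 derivC mulr0 subr0.
Qed.

Lemma ratfun_derivX : ratfun_deriv ratX = 1.
Proof. by rewrite ratfun_deriv_poly derivX rmorph1. Qed.

Lemma ratfun_deriv_derivation : derivation ratfun_deriv.
Proof.
have key f p q : f * q%:F = p%:F -> q != 0 ->
    ratfun_deriv f = (p^`() * q - p * q^`())%:F / (q ^+ 2)%:F.
  move=> fq q0; rewrite -(ratfun_derivE fq q0) mulfK //.
  by rewrite ratfun_of_poly_eq0 expf_neq0.
have nz p : p != 0 -> p%:F != 0 by rewrite ratfun_of_poly_eq0.
split=> [c|] f g.
- have := repr_ratfun f; have := denom_ratioP (repr f).
  move: (\n_(repr f)) (\d_(repr f)) => n d d0 fd.
  have := repr_ratfun g; have := denom_ratioP (repr g).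
  move: (\n_(repr g)) (\d_(repr g)) => m e e0 ge.
  rewrite (key f _ _ fd d0) (key g _ _ ge e0).
  have de0 : d * e != 0 by rewrite mulf_neq0.
  have h : (c *: f + g) * (d * e)%:F = (c%:P * n * e + m * d)%:F.
    by rewrite ratfun_scaleE !(rmorphD, rmorphM) /= -fd -ge; ring.
  apply: (mulIf (nz _ (expf_neq0 2 de0))); rewrite (ratfun_derivE h de0).
  rewrite !ratfun_scaleE !derivD !derivM derivC.
  rewrite !(rmorphD, rmorphN, rmorphM, rmorphXn) /= rmorph0.
  exact: (quotient_ruleD _ _ _ _ _ _ _ (nz d d0) (nz e e0)).
- have := repr_ratfun f; have := denom_ratioP (repr f).
  move: (\n_(repr f)) (\d_(repr f)) => n d d0 fd.
  have := repr_ratfun g; have := denom_ratioP (repr g).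
  move: (\n_(repr g)) (\d_(repr g)) => m e e0 ge.
  have -> : ratfun_deriv (f * g) = ((n * m)^`() * (d * e)
      - (n * m) * (d * e)^`())%:F / ((d * e) ^+ 2)%:F.
    apply: key; last by rewrite mulf_neq0.
    by rewrite !rmorphM /= -fd -ge; ring.
  rewrite (key f _ _ fd d0) (key g _ _ ge e0).
  have -> : f = n%:F / d%:F by rewrite -fd mulfK ?nz.
  have -> : g = m%:F / e%:F by rewrite -ge mulfK ?nz.
  rewrite !derivM !(rmorphD, rmorphN, rmorphM, rmorphXn) /=.
  exact: (quotient_ruleM _ _ _ _ _ _ (nz d d0) (nz e e0)).
Qed.

End RationalFunctions.

Section Ra.
Variables (K : fieldType) (n : nat) (a : n.-tuple K).
Local Notation d := (@ratfun_deriv K).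

Definition Ra_gens (f : ratfun K) : Prop :=
  f = ratX K \/ exists2 b, b \in a & f = (ratX K - b%:A)^-1.

Definition Ra_pred : {pred ratfun K} := genalg Ra_gens.
HB.instance Definition _ := GRing.SubalgClosed.on Ra_pred.

Definition Ra : Type := {f : ratfun K | f \in Ra_pred}.
HB.instance Definition _ := SubType.on Ra.
HB.instance Definition _ := [Choice of Ra by <:].
HB.instance Definition _ := [SubChoice_isSubAlgebra of Ra by <:].
HB.instance Definition _ := [SubNzRing_isSubComNzRing of Ra by <:].

(* The lemmas [vfield_bij], [vfield_linear] and [lie_vfield] below identify this
   Lie algebra of derivations with Ra d/dt and its explicit bracket. *)
Definition Va : Type := Der Ra.
HB.instance Definition _ := LieAlgebra.on Va.

Lemma ratX_sub_neq0 (b : K) : ratX K - b%:A != 0.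
Proof.
rewrite ratfun_scaleE mulr1 -rmorphB /= ratfun_of_poly_eq0.
by rewrite polyXsubC_eq0.
Qed.

Lemma derivation1 (A : comAlgType K) (D : A -> A) : derivation D -> D 1 = 0.
Proof.
move=> [_ mD]; have := mD 1 1; rewrite !mulr1 mul1r => /esym/eqP.
by rewrite -subr_eq0 addrK => /eqP.
Qed.

Lemma Ra_t_subproof : ratX K \in Ra_pred.
Proof. by apply: sub_genalg; left. Qed.

Lemma Ra_inv_subproof b : b \in a -> (ratX K - b%:A)^-1 \in Ra_pred.
Proof.
by move=> ab; apply: sub_genalg; right; exists b.
Qed.

Definition Ra_t : Ra := Sub (ratX K) Ra_t_subproof.

Lemma ratfun_deriv_Ra f : f \in Ra_pred -> d f \in Ra_pred.
Proof.
have [lD mD] := ratfun_deriv_derivation K.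
have D1 := derivation1 (ratfun_deriv_derivation K).
pose S : {pred ratfun K} := fun g => (g \in Ra_pred) && (d g \in Ra_pred).
move=> /asboolP/(_ S) Sf; apply: proj2; apply/andP; apply: Sf.
  split=> [|c g h /andP[g1 g2] /andP[h1 h2]|g h /andP[g1 g2] /andP[h1 h2]].
  - by apply/andP; rewrite D1 rpred1 rpred0.
  - by apply/andP; rewrite lD !rpredD ?rpredZ.
  - apply/andP; rewrite mD.
    by split; [apply: rpredM|apply: rpredD; apply: rpredM].
move=> g [->|[b ab ->]].
  by apply/andP; rewrite ratfun_derivX rpred1 Ra_t_subproof.
apply/andP; rewrite Ra_inv_subproof //; split=> //.
set u := _ - _; have u0 : u != 0 by apply: ratX_sub_neq0.
have Du : d u = 1.
  have -> : u = (- b) *: 1 + ratX K by rewrite scaleNr addrC.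
  by rewrite lD D1 scaler0 add0r ratfun_derivX.
have : d (u * u^-1) = 0 by rewrite divff.
rewrite mD Du mul1r addrC => /eqP; rewrite addr_eq0 => /eqP e.
have -> : d u^-1 = - (u^-1 * u^-1) by rewrite -mulrN -e mulKf.
by rewrite rpredN rpredM // Ra_inv_subproof.
Qed.

Definition Ra_deriv (f : Ra) : Ra := Sub (d (val f)) (ratfun_deriv_Ra (valP f)).

Lemma Ra_deriv_derivation : derivation Ra_deriv.
Proof.
have [lD mD] := ratfun_deriv_derivation K.
by split=> [c|] f g; apply: val_inj; [apply: lD|apply: mD].
Qed.

Lemma derivation_Ra_eq0 (D : Ra -> Ra) :
  derivation D -> D Ra_t = 0 -> forall f, D f = 0.
Proof.
move=> /[dup] /derivation1 D1 [lD mD] Dt f.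
pose S : {pred ratfun K} :=
  fun g => `[< exists r : Ra, val r = g /\ D r = 0 >].
have : val f \in S.
  move: (valP f) => /asboolP/(_ S); apply.
    split=> [|c _ _ /asboolP[r [<- Dr]] /asboolP[s [<- Ds]]
             |_ _ /asboolP[r [<- Dr]] /asboolP[s [<- Ds]]]; apply/asboolP.
    - by exists 1.
    - by exists (c *: r + s); rewrite lD Dr Ds scaler0 addr0.
    - by exists (r * s); rewrite mD Dr Ds mul0r mulr0 addr0.
  move=> g [->|[b ab ->]]; apply/asboolP.
    by exists Ra_t.
  pose v : Ra := Sub (ratX K - b%:A)^-1 (Ra_inv_subproof ab).
  exists v; split=> //.
  pose u : Ra := (- b) *: 1 + Ra_t.
  have uE : val u = ratX K - b%:A.
    by change ((- b)%:A + ratX K = ratX K - b%:A); rewrite scaleNr addrC.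
  have uv : u * v = 1.
    apply: val_inj; change (val u * (ratX K - b%:A)^-1 = 1).
    by rewrite uE divff // ratX_sub_neq0.
  have Du : D u = 0 by rewrite lD D1 Dt scaler0 addr0.
  have := mD u v; rewrite uv D1 Du mul0r add0r => /esym uDv.
  by rewrite -[D v]mul1r -uv mulrAC uDv mul0r.
by move=> /asboolP[r [/val_inj<-]].
Qed.

Lemma vfield_subproof (f : Ra) : derivation (fun g => f * Ra_deriv g).
Proof.
have [lD mD] := Ra_deriv_derivation.
split=> [c|] g h; first by rewrite lD mulrDr scalerAr.
by rewrite mD; ring.
Qed.

(* [vfield f] is the vector field f d/dt. *)
Definition vfield (f : Ra) : Va := mkDer (vfield_subproof f).

Lemma vfield_bij : bijective vfield.
Proof.
exists (fun D : Va => val D Ra_t) => [f|D].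
  apply: val_inj; change (val f * d (ratX K) = val f).
  by rewrite ratfun_derivX mulr1.
apply: DerP => f; apply/esym/eqP; rewrite -subr_eq0; apply/eqP.
set f0 := val D Ra_t; pose E g := val D g - f0 * Ra_deriv g.
apply: (@derivation_Ra_eq0 E); last first.
  rewrite /E; have -> : Ra_deriv Ra_t = 1 by apply/val_inj/ratfun_derivX.
  by rewrite mulr1 subrr.
have [lD mD] := Der_derivation D; have [lE mE] := vfield_subproof f0.
rewrite /E; split=> [c|] g h.
  by rewrite lD lE scalerBr opprD addrACA.
by rewrite mD mE; ring.
Qed.

Lemma vfield_linear : linear vfield.
Proof.
move=> c f g; apply: DerP => h.
change ((c *: f + g) * Ra_deriv h = c *: (f * Ra_deriv h) + g * Ra_deriv h).
by rewrite mulrDl scalerAl.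
Qed.

Lemma lie_vfield f g :
  lie (vfield f) (vfield g) = vfield (f * Ra_deriv g - g * Ra_deriv f).
Proof.
have [_ mD] := Ra_deriv_derivation.
apply: DerP => h.
change (f * Ra_deriv (g * Ra_deriv h) - g * Ra_deriv (f * Ra_deriv h)
        = (f * Ra_deriv g - g * Ra_deriv f) * Ra_deriv h).
by rewrite !mD; ring.
Qed.

End Ra.

(* Main.v *)
(** In a commutative algebra with a derivation d and an element t such that
    d t = 1, write [f, g] = f d g - g d f and let e be a derivation of this
    bracket.  Applying e to [1, t] = 1 shows that e 1 = d (t e 1 - e t), so that
    e and ad h agree at 1 and t for h = e t - t e 1.  If e 1 = e t = 0, then
    [t, t^2] = t^2 gives e (t^2) = 0, and comparing the brackets of f with 1, t
    and t^2 gives 3 e (t f) = 3 t e f.  Hence e is linear over polynomials in t,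
    and kills every fraction of polynomials since it kills 1. *)

Require Import Defs.
From HB Require Import structures.
From mathcomp Require Import all_boot all_algebra reals complex.
From mathcomp Require Import ring.

Set Implicit Arguments.
Unset Strict Implicit.
Unset Printing Implicit Defensive.

Import GRing.Theory Num.Theory.
Local Open Scope ring_scope.

Section Wronskian.
Variables (K : fieldType) (A : comAlgType K) (d : {linear A -> A}) (t : A).

Definition wronskian (f g : A) : A := f * d g - g * d f.

Definition wronskian_derivation (e : A -> A) : Prop :=
  forall f g, e (wronskian f g) = wronskian (e f) g + wronskian f (e g).

Lemma wronskian_linear h : linear (wronskian h).
Proof.
move=> c f g; rewrite /wronskian linearP mulrDr mulrDl scalerBr.
by rewrite -scalerAr -scalerAl; ring.
Qed.

HB.instance Definition _ h := GRing.isLinear.Build K A A *:%R (wronskian h)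
  (wronskian_linear h).

Hypotheses (dd : derivation d) (dt : d t = 1).

Let dM f g : d (f * g) = d f * g + f * d g.
Proof. by have [_] := dd. Qed.

Let d1 : d 1 = 0 := derivation1 dd.

(** This is the Jacobi identity; it allows an inner part to be subtracted from [e]. *)
Lemma wronskian_ad h : wronskian_derivation (wronskian h).
Proof. by move=> f g; rewrite /wronskian !raddfB /= !dM; ring. Qed.

Lemma wronskian_derivationB (e e' : A -> A) :
  wronskian_derivation e -> wronskian_derivation e' ->
  wronskian_derivation (e \- e').
Proof. by move=> we we' f g /=; rewrite we we' /wronskian !raddfB /=; ring. Qed.

Lemma wronskian_derivation_at1 e : wronskian_derivation e ->
  e 1 = wronskian (e t - t * e 1) 1.
Proof.
move=> /(_ 1 t); rewrite /wronskian dt d1 !mulr0 !mulr1 !mul1r !subr0 => e1.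
(* The two terms [e 1] cancel in the image of [[1, t] = 1] under [e]. *)
have det : d (e t) = t * d (e 1).
  by apply: (addrI (e 1 - t * d (e 1))); rewrite subrK -e1.
by rewrite raddfB /= dM dt det; ring.
Qed.

(** With [h = e t - t * e 1], the value at [1] reads [e 1 = - d h], so [h - t * d h = e t]. *)
Lemma wronskian_derivation_att e : wronskian_derivation e ->
  e t = wronskian (e t - t * e 1) t.
Proof.
move=> /wronskian_derivation_at1; rewrite /wronskian dt d1 => e1.
by move: (d _) e1 => x ->; ring.
Qed.

Lemma wronskian_derivation_mult (e : {linear A -> A}) f :
  (2 != 0 :> K) -> (3 != 0 :> K) ->
  wronskian_derivation e -> e 1 = 0 -> e t = 0 -> e (t * f) = t * e f.
Proof.
move=> nz2 nz3 we e1 et.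
have reg m (x : A) : (m%:R != 0 :> K) -> x *+ m = 0 -> x = 0.
  by move=> /negPf m0 /eqP; rewrite -scaler_nat scaler_eq0 m0 /= => /eqP.
(* Bracketing with [1] is [d] itself. *)
have ed g : e (d g) = d (e g).
  have := we 1 g.
  by rewrite /wronskian e1 d1 raddf0 !mul1r !mulr0 !mul0r !subr0 add0r.
(* Bracketing with [t] sends [g] to [t * d g - g]; the terms [e g] cancel. *)
have etd g : e (t * d g) = t * e (d g).
  have := we t g; rewrite /wronskian et dt raddf0 !mulr1 !mul0r !mulr0.
  by rewrite subrr add0r raddfB /= -ed => /addIr.
have dt2 : d (t * t) = t *+ 2 by rewrite dM dt mul1r mulr1.
have det2 : d (e (t * t)) = 0 by rewrite -ed dt2 raddfMn /= et mul0rn.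
(* Applying [e] to [[t, t^2] = t^2] gives [e (t^2) = - e (t^2)], because [d (e (t^2)) = 0]. *)
have et2 : e (t * t) = 0.
  apply: (reg 2) => //; have := we t (t * t).
  rewrite /wronskian et dt raddf0 det2 dt2 !mulr1 !mul0r !mulr0 subrr !add0r.
  have -> : t * (t *+ 2) - t * t = t * t by ring.
  by move=> h; rewrite mulr2n {1}h addNr.
have e2 := we (t * t) f.
rewrite /wronskian et2 raddf0 dt2 mul0r mulr0 subrr add0r raddfB /= in e2.
(* Writing [t * d f] as [d (t * f) - f] makes [etd] apply to [t * f]; the term [- e (t * f)] joins
   the two copies in [e2], whence the factor 3. *)
have ett : e (t * (t * d f)) = t * (t * d (e f)) + t * e f - e (t * f).
  have -> : t * d f = d (t * f) - f by rewrite dM dt; ring.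
  rewrite mulrBr raddfB /= etd dM dt mul1r raddfD /= etd ed; ring.
rewrite -mulrA ett (_ : f * (t *+ 2) = (t * f) *+ 2) in e2; last by ring.
rewrite raddfMn /= in e2.
apply/eqP; rewrite -subr_eq0; apply/eqP; apply: (reg 3) => //.
move/eqP: e2; rewrite -subr_eq0 => /eqP e2.
by rewrite -[RHS]oppr0 -e2; ring.
Qed.

End Wronskian.

Section VectorFields.
Variables (K : fieldType) (n : nat) (a : n.-tuple K).
Local Notation Ra := (Ra a).
Local Notation Va := (Va a).
Local Notation t := (Ra_t a).

HB.instance Definition _ := GRing.isLinear.Build K Ra Ra *:%R (@Ra_deriv K n a)
  (Ra_deriv_derivation a).1.

HB.instance Definition _ := GRing.isLinear.Build K Ra Va *:%R (@vfield K n a)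
  (@vfield_linear K n a).

Definition vcoord (D : Va) : Ra := val D t.

Lemma vcoord_linear : linear vcoord.
Proof. by []. Qed.

HB.instance Definition _ := GRing.isLinear.Build K Va Ra *:%R vcoord
  vcoord_linear.

Lemma Ra_deriv_t : Ra_deriv t = 1.
Proof. exact/val_inj/ratfun_derivX. Qed.

Lemma vfieldK : cancel (@vfield K n a) vcoord.
Proof. by move=> f; rewrite /vcoord /= Ra_deriv_t mulr1. Qed.

Lemma vcoordK : cancel vcoord (@vfield K n a).
Proof. exact/(bij_can_sym (vfield_bij a))/vfieldK. Qed.

(** If [q * f = p] with polynomials [p] and [q != 0], then [q * e f = e p = p * e 1 = 0] inside a
    field. *)
Lemma Ra_mult_eq0 (e : {linear Ra -> Ra}) :
  (forall f, e (t * f) = t * e f) -> e 1 = 0 -> forall f, e f = 0.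
Proof.
move=> et e1 f.
(* Polynomials are lifted to [Ra], where [e] is defined, by induction along Horner's scheme. *)
have poly p : exists P : Ra, val P = ratfun_of_poly p /\
    forall g, e (P * g) = P * e g.
  elim/poly_ind: p => [|p c [P [vP eP]]].
    by exists 0; split=> [|g]; rewrite ?rmorph0 // !mul0r raddf0.
  exists (P * t + c *: 1); split=> [|g].
    rewrite [RHS]rmorphD [X in _ = X + _]rmorphM /= -vP.
    by rewrite -[ratfun_of_poly c%:P]mulr1 -ratfun_scaleE.
  by rewrite !mulrDl -!scalerAl !mul1r -!mulrA linearD linearZ /= eP et.
have [P [vP eP]] := poly \n_(repr (val f)).
have [Q [vQ eQ]] := poly \d_(repr (val f)).
have fQ : Q * f = P.
  by apply: val_inj; rewrite /= vQ vP -repr_ratfun mulrC.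
have /(congr1 val)/eqP : Q * e f = 0 by rewrite -eQ fQ -[P]mulr1 eP e1 mulr0.
rewrite /= mulf_eq0 vQ ratfun_of_poly_eq0 (negPf (denom_ratioP _)) /=.
by move=> /eqP ?; apply: val_inj.
Qed.

Lemma Va_derivation_inner (D : {linear Va -> Va}) :
  (2 != 0 :> K) -> (3 != 0 :> K) -> lie_derivation D -> inner_derivation D.
Proof.
move=> nz2 nz3 lD.
have dd := Ra_deriv_derivation a; have dt := Ra_deriv_t.
(* [D] is transported to coefficients, where the Lie bracket becomes the Wronskian. *)
pose e : {linear Ra -> Ra} := vcoord \o D \o @vfield K n a.
have eE f : vfield (e f) = D (vfield f) by rewrite /e /= vcoordK.
have we : wronskian_derivation (@Ra_deriv K n a) e.
  move=> f g; apply: (can_inj vfieldK).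
  by rewrite /wronskian eE -lie_vfield lD -!eE !lie_vfield [RHS]linearD.
pose h := e t - t * e 1.
have wh := wronskian_derivationB we (wronskian_ad dd h).
have e1 : (e \- wronskian (@Ra_deriv K n a) h) 1 = 0.
  by rewrite /= -wronskian_derivation_at1 ?subrr.
have et : (e \- wronskian (@Ra_deriv K n a) h) t = 0.
  by rewrite /= -wronskian_derivation_att ?subrr.
(* The difference of [e] and the bracket with [h] vanishes at [1] and [t], hence commutes with
   multiplication by [t]. *)
have eh := Ra_mult_eq0
  (fun f => wronskian_derivation_mult dd dt f nz2 nz3 wh e1 et) e1.
exists (vfield h) => y; rewrite -[y]vcoordK lie_vfield.
by apply: (can_inj vcoordK); rewrite vfieldK; apply/subr0_eq/eh.
Qed.

End VectorFields.

Theorem theorem15 (R : realType) (n : nat) (hn : (0 < n)%N)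
    (a : n.-tuple R[i]) (ha : uniq a) (D : {linear Va a -> Va a}) :
  lie_derivation D -> inner_derivation D.
Proof. by apply: Va_derivation_inner; rewrite pnatr_eq0. Qed.
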